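(* Consider a one-zone market with inflexible demand $d>0$ and active producer set $\mathcal{P}$ (a finite set), with no producer capacity constraints and no network constraints, cleared by the simplified social welfare maximisation mechanism described in the context. Assume that the demand $d$ and the cost structure $\{c_i,b_i\}_{i\in\mathcal{P}}$ are common knowledge, that $c_i>0$ for every $i\in\mathcal{P}$, and that each producer $i$ aims to maximise its profit $\pi_i(m_i,a_i,m_{-i},a_{-i})=vx_i-\frac12 c_ix_i^2-b_ix_i$, where $v$ is the zonal clearing price and $x_i$ the cleared quantity. Let the strategy of each producer $i$ be the pair $(m_i,a_i)$ with $m_i\ge\frac12 c_i$ and $a_i\in\mathbb{R}$ (so both $m_i$ and $a_i$ are chosen strategically). Write $\mathcal{M}=\{m\in\mathbb{R}^{\mathcal{P}}: m_i\ge \frac12 c_i\ \forall i\}$ and $\mathcal{A}=\mathbb{R}^{\mathcal{P}}$. For each $m^+\in\mathcal{M}$ let $a^+(m^+)\in\mathcal{A}$ be the unique Nash equilibrium of the game in which $m=m^+$ is held fixed and only the $a_i$ are strategy variables, i.e. the solution of the linear system $$\theta_i\sum_{j\in\mathcal{P}\setminus\{i\}}\frac{a_i^+}{m_j^+}-\sum_{j\in\mathcal{P}\setminus\{i\}}\frac{a_j^+}{m_j^+}=d+(\theta_i-1)\sum_{j\in\mathcal{P}\setminus\{i\}}\frac{b_i}{m_j^+},\qquad i\in\mathcal{P},$$ where $\theta_i=\frac{2-k_iK_{-i}^2}{1-k_iK_{-i}^2}$, $k_i=2m_i^+-c_i$ and $K_{-i}^2=\frac{\sum_{j\in\mathcal{P}\setminus\{i\}}(m_j^+)^{-1}}{m_i^+\sum_{j\in\mathcal{P}}(m_j^+)^{-1}}$.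 Then for each $m^+\in\mathcal{M}$ the point $(m^+,a^+(m^+))$ is a local Nash equilibrium in the $(m,a)\in\mathcal{M}\times\mathcal{A}$ space. In particular, there are infinitely many local Nash equilibria. Further, these local equilibria form a continuous subspace $\mathcal{MA}^+=\{(m^+,a^+(m^+)):m^+\in\mathcal{M}\}$ of $\mathcal{M}\times\mathcal{A}$, i.e. $a^+(m^+)$ varies continuously with $m^+$.
   Context: Each producer $i\in\mathcal{P}$ has production cost $C_i(x_i)=\frac12c_ix_i^2+b_ix_i$ and submits an order consisting of a linear marginal ask price $\lambda_i(x_i)=m_ix_i+a_i$, determined by the pair $(m_i,a_i)$. Given all orders, the market is cleared by solving $$\min_x\ \sum_{i\in\mathcal{P}}\Big(\tfrac12m_ix_i^2+a_ix_i\Big)\quad\text{s.t. }\sum_{i\in\mathcal{P}}x_i=d,\quad x_i\ge0\ \ \forall i .$$ With $x^*$ the optimal solution, producer $i$ is allocated the quantity $x_i=x_i^*$, and the zonal clearing price is $v=\max_{k\in\mathcal{P}}\{m_kx_k^*+a_k: x_k^*>0\}$. A producer is called active if $x_i^*>0$; ''active producer set $\mathcal{P}$'' means that only active producers are considered. The profit $\pi_i$ is a function of all orders through $v$ and $x_i$. The superscript in $K_{-i}^2$ is an index, not a power. The notation $m_{-i},a_{-i}$ denotes the values of all players other than $i$. A Nash equilibrium is a strategy profile from which no player can increase its profit by a unilateral change of its own strategy; a local Nash equilibrium is a strategy profile at which each player's own strategy is a local maximiser of its profit, given the strategies of the other players.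
   Formalization: At least two producers are assumed (with one, the system reads 0=d); where 1-k_iK_{-i}^2=0, so theta_i is undefined, the i-th equation is replaced by its limit a_i=b_i; the equilibrium claims are for profiles at which all producers are active. *)

(* Defs.v *)
From HB Require Import structures.
From mathcomp Require Import all_boot all_order all_algebra.
From mathcomp Require Import all_classical all_reals all_analysis.
Set Implicit Arguments.
Unset Strict Implicit.
Unset Printing Implicit Defensive.
Import Order.TTheory GRing.Theory Num.Theory.
Import numFieldNormedType.Exports.
Local Open Scope classical_set_scope.
Local Open Scope ring_scope.

Section Games.
Variables (P : finType) (R : realType).

Definition nash (T : Type) (S : P -> set T) (u : (P -> T) -> P -> R)
    (s : P -> T) : Prop :=
  (forall i, S i (s i)) /\
  forall i t, S i t -> u [eta s with i |-> t] i <= u s i.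

Definition local_nash (T : topologicalType) (S : P -> set T)
    (u : (P -> T) -> P -> R) (s : P -> T) : Prop :=
  (forall i, S i (s i)) /\
  forall i, \forall t \near within (S i) (nbhs (s i)),
    u [eta s with i |-> t] i <= u s i.

End Games.

Section Market.
Variables (P : finType) (R : realType) (d : R) (c b : P -> R).

(* An order book [o] assigns to each producer its order [o i = (m_i, a_i)]. *)
Definition orders (m a : P -> R) : P -> R * R := fun i => (m i, a i).

Definition feasible (x : P -> R) : Prop :=
  \sum_i x i = d /\ forall i, 0 <= x i.

Definition ask_cost (o : P -> R * R) (x : P -> R) : R :=
  \sum_i (2^-1 * (o i).1 * x i ^+ 2 + (o i).2 * x i).

Definition is_clearing (o : P -> R * R) (x : P -> R) : Prop :=
  feasible x /\ forall y, feasible y -> ask_cost o x <= ask_cost o y.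

(* When [0 <= d], [P] is nonempty and all slopes are positive, the clearing
   problem has exactly one solution, so the choice made by [xget] is forced and
   its default value is not used. *)
Definition allocation (o : P -> R * R) : P -> R :=
  xget (fun=> 0) [set x | is_clearing o x].

(* If [0 < d], this is the supremum of a nonempty finite set: a maximum. *)
Definition price (o : P -> R * R) : R :=
  sup [set (o k).1 * allocation o k + (o k).2 | k in
        [set k | 0 < allocation o k]].

Definition profit (o : P -> R * R) (i : P) : R :=
  price o * allocation o i - 2^-1 * c i * allocation o i ^+ 2
  - b i * allocation o i.

Definition all_active (o : P -> R * R) : Prop := forall i, 0 < allocation o i.

Definition slopes : set (P -> R) := [set m | forall i, 2^-1 * c i <= m i].

Definition strategies (i : P) : set (R * R) := [set t | 2^-1 * c i <= t.1].

Definition kcoef (m : P -> R) (i : P) : R := 2 * m i - c i.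

(* The superscript 2 of K^2_{-i} is an index, not an exponent. *)
Definition K2 (m : P -> R) (i : P) : R :=
  (\sum_(j | j != i) (m j)^-1) / (m i * \sum_j (m j)^-1).

Definition theta (m : P -> R) (i : P) : R :=
  (2 - kcoef m i * K2 m i) / (1 - kcoef m i * K2 m i).

(* For some admissible slopes 1 - k_i K^2_{-i} vanishes and theta_i has a pole.
   The i-th equation is then read after division by theta_i, in the limit
   where theta_i tends to infinity. *)
Definition linear_system (m a : P -> R) : Prop :=
  forall i,
    if 1 - kcoef m i * K2 m i == 0 then
      \sum_(j | j != i) a i / m j = \sum_(j | j != i) b i / m j
    else
      theta m i * (\sum_(j | j != i) a i / m j) - \sum_(j | j != i) a j / m j
      = d + (theta m i - 1) * \sum_(j | j != i) b i / m j.

Definition intercept_nash (m a : P -> R) : Prop :=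
  nash (fun=> setT) (fun a' => profit (orders m a')) a.

End Market.

(* Main.v *)
(* Given the other orders, a producer only chooses a point on its residual demand
   curve, whether it moves m_i, a_i or both. While everyone is active this curve
   is the line of slope -1 / S, S = \sum_(j != i) 1 / m_j, and the profit along it
   is a strictly concave quadratic, so an equilibrium in the intercepts is
   characterised by the first-order conditions
   x_i = w_i (v - b_i), w_i = S / (1 + c_i S); the demand then fixes v, and
   a_i = v - m_i x_i. A deviation that drives others out of the market only lowers
   the price below that line, so the profile is in fact a global equilibrium in
   the pairs (m_i, a_i). *)
Require Import Defs.
From mathcomp Require Import all_boot all_order all_algebra.
From mathcomp Require Import all_classical all_reals all_analysis.
From mathcomp Require Import ring lra.
Set Implicit Arguments.
Unset Strict Implicit.
Unset Printing Implicit Defensive.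
Import Order.TTheory GRing.Theory Num.Theory.
Import numFieldNormedType.Exports.
Local Open Scope classical_set_scope.
Local Open Scope ring_scope.

(** * Convergence in function spaces and of finite sums *)

Lemma cvg_ptws (I : eqType) (X : Type) (T : topologicalType) (F : set_system X)
    (f : X -> {ptws I -> T}) (g : {ptws I -> T}) : Filter F ->
  (forall i, f x i @[x --> F] --> g i) -> f x @[x --> F] --> g.
Proof.
move=> FF fg.
have Ff : Filter (f x @[x --> F]) by exact: fmap_filter.
apply/cvg_sup => i A.
rewrite nbhsE => -[_ [[V oV <-] Vg] VA].
have /fg : nbhs (g i) V by exact: open_nbhs_nbhs.
by apply: (@filterS _ F) => x; exact: VA.
Qed.

Lemma cvg_sumr (R : realType) (I X : Type) (F : set_system X) (r : seq I)
    (Q : pred I) (f : I -> X -> R) (l : I -> R) : Filter F ->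
  (forall i, f i x @[x --> F] --> l i) ->
  \sum_(i <- r | Q i) f i x @[x --> F] --> \sum_(i <- r | Q i) l i.
Proof.
by move=> FF fl; apply: cvg_big => [|i _]; [exact: add_continuous|exact: fl].
Qed.

Section Market.
Context (R : realType) (P : finType) (d : R) (c b : P -> R).
Implicit Types (o : P -> R * R) (x y m a : P -> R) (i j k l : P).

(** * Optimality in the clearing problem and the clearing price *)

Lemma ask_costB o x y : ask_cost o y - ask_cost o x =
  \sum_i (2^-1 * (o i).1 * (y i - x i) ^+ 2
          + ((o i).1 * x i + (o i).2) * (y i - x i)).
Proof. by rewrite /ask_cost -sumrB; apply: eq_bigr => i _; field. Qed.

Lemma clearing_marginal_le o x k l : (forall i, 0 < (o i).1) ->
  is_clearing d o x -> 0 < x l ->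
  (o l).1 * x l + (o l).2 <= (o k).1 * x k + (o k).2.
Proof.
move=> o_gt0 [[sumx x_ge0] x_min] xl_gt0.
have [-> //|neq_kl] := eqVneq k l.
rewrite leNgt; apply/negP; set pk := (X in X < _); set pl := (X in _ < X).
move=> lt_p; pose s := (o k).1 + (o l).1.
have s_gt0 : 0 < s by apply: addr_gt0.
(* The bound [x l] keeps the transfer feasible; the bound [(pl - pk) / s] keeps the quadratic cost
   at most half of the first-order gain. *)
pose e := Num.min (x l) ((pl - pk) / s).
have e_gt0 : 0 < e by rewrite lt_min xl_gt0 divr_gt0 // subr_gt0.
have e_xl : e <= x l by rewrite ge_min lexx.
have e_s : e * s <= pl - pk by rewrite -ler_pdivlMr // ge_min lexx orbT.
(* Transferring the quantity [e] from [l] to [k] is cheaper to first order. *)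
pose y j := x j + e * ((j == k)%:R - (j == l)%:R).
have yBx j : y j - x j = e * ((j == k)%:R - (j == l)%:R).
  by rewrite /y addrC addKr.
have split_sum (F : P -> R) : (forall j, j != k -> j != l -> F j = 0) ->
    \sum_j F j = F k + F l.
  move=> F0; rewrite (bigD1 k) //= (bigD1 l) 1?eq_sym //= big1 ?addr0 //.
  by move=> j /andP[jk jl]; exact: F0.
have /x_min : feasible d y.
  split.
    rewrite -sumx; apply/eqP; rewrite -subr_eq0 -sumrB; apply/eqP.
    under eq_bigr do rewrite yBx.
    rewrite split_sum ?eqxx => [|j /negPf-> /negPf->]; last by rewrite subrr mulr0.
    by rewrite [l == k]eq_sym (negPf neq_kl); ring.
  move=> j; rewrite /y; have [->|jl] := eqVneq j l.
    by rewrite [l == k]eq_sym (negPf neq_kl) mulr0n mulr1n; lra.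
  by rewrite subr0 addr_ge0 // mulr_ge0 // ltW.
rewrite -subr_ge0 ask_costB split_sum => [|j jk jl]; last first.
  by rewrite yBx (negPf jk) (negPf jl) subrr; ring.
rewrite !yBx !eqxx [l == k]eq_sym (negPf neq_kl) -/pk -/pl subr0 sub0r.
rewrite !mulr1n => cost_ge0.
have : e * (2^-1 * (e * s) - (pl - pk)) < 0 by rewrite pmulr_rlt0 //; lra.
by rewrite ltNge => /negP; apply; rewrite /s; lra.
Qed.

Lemma allocation_cases o :
  is_clearing d o (allocation d o) \/ allocation d o = fun=> 0.
Proof.
by rewrite /allocation; case: xgetP => [x _ clr|_]; [left | right].
Qed.

(** The default of [xget] is zero everywhere, so one positive quantity certifies a true
    minimiser. *)
Lemma allocation_is_clearing o i :
  0 < allocation d o i -> is_clearing d o (allocation d o).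
Proof. by case: (allocation_cases o) => // ->; rewrite ltxx. Qed.

(** Comparing two active producers both ways equates their marginal asks, so the supremum is over a
    singleton. *)
Lemma priceE o l : (forall i, 0 < (o i).1) -> 0 < allocation d o l ->
  price d o = (o l).1 * allocation d o l + (o l).2.
Proof.
move=> o_gt0 xl; have clr := allocation_is_clearing xl; rewrite /price.
rewrite (_ : [set _ | _ in _] = [set (o l).1 * allocation d o l + (o l).2]).
  exact: sup1.
apply/seteqP; split => [_ [k /= xk <-]|_ ->]; last by exists l.
by apply: le_anti; rewrite !(@clearing_marginal_le o _ _ _ o_gt0 clr).
Qed.

(** With equal marginal asks the linear part of [ask_costB] vanishes on the demand hyperplane; the
    definite quadratic form that remains gives both optimality and uniqueness. *)
Lemma allocationE o x v : (forall i, 0 < (o i).1) -> \sum_i x i = d ->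
  (forall i, 0 <= x i) -> (forall i, (o i).1 * x i + (o i).2 = v) ->
  allocation d o = x.
Proof.
move=> o_gt0 sumx x_ge0 xv.
have costB y : \sum_i y i = d -> ask_cost o y - ask_cost o x =
    \sum_i 2^-1 * (o i).1 * (y i - x i) ^+ 2.
  move=> sumy; rewrite ask_costB big_split /=.
  under [X in _ + X]eq_bigr do rewrite xv.
  by rewrite -mulr_sumr sumrB sumx sumy subrr mulr0 addr0.
have term_ge0 y i : 0 <= 2^-1 * (o i).1 * (y i - x i) ^+ 2.
  by rewrite mulr_ge0 ?sqr_ge0 // mulr_ge0 ?invr_ge0 // ltW.
have clr : is_clearing d o x.
  split=> // y [sumy _]; rewrite -subr_ge0 costB //.
  by apply: sumr_ge0 => i _.
have [[sumy y_ge0] y_min] : is_clearing d o (allocation d o).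
  exact: (@xgetI _ _ [set x | is_clearing d o x] _ clr).
have := y_min x (conj sumx x_ge0); rewrite -subr_le0 costB // => sum_le0.
have /eqP : \sum_i 2^-1 * (o i).1 * (allocation d o i - x i) ^+ 2 = 0.
  by apply: le_anti; rewrite sum_le0 sumr_ge0.
rewrite psumr_eq0 // => /allP sq0; apply/funext => i.
have /eqP := sq0 i (mem_index_enum i).
move/eqP; rewrite /= !mulf_eq0 invr_eq0 pnatr_eq0 /= gt_eqF //=.
by rewrite orbb subr_eq0 => /eqP.
Qed.

(** * Residual demand and the profit along it *)

Definition residual_slope m i : R := \sum_(j | j != i) (m j)^-1.

Definition residual_intercept m a i : R := d + \sum_(j | j != i) a j / m j.

(* The profit of [i] if it sells [x] on the line where its competitors, all of
   them active, supply the remaining demand. *)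
Definition residual_profit m a i (x : R) : R :=
  x * ((residual_intercept m a i - x) / residual_slope m i)
  - 2^-1 * c i * x ^+ 2 - b i * x.

Lemma eq_residual_profit m a m' a' i :
  (forall j, j != i -> m j = m' j) -> (forall j, j != i -> a j = a' j) ->
  residual_profit m a i = residual_profit m' a' i.
Proof.
move=> eq_m eq_a; rewrite /residual_profit.
have -> : residual_slope m i = residual_slope m' i.
  by apply: eq_bigr => j ji; rewrite eq_m.
suff -> : residual_intercept m a i = residual_intercept m' a' i by [].
by congr (_ + _); apply: eq_bigr => j ji; rewrite eq_m ?eq_a.
Qed.

(** The derivative of [residual_profit] is zero, cleared of the denominator [residual_slope m i]. *)
Definition first_order m a i (x : R) : Prop :=
  x * (2 + c i * residual_slope m i) =
  residual_intercept m a i - b i * residual_slope m i.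

Hypotheses (card_P : (1 < #|P|)%N) (d_gt0 : 0 < d) (c_gt0 : forall i, 0 < c i).

Lemma residual_slope_gt0 m i : (forall j, 0 < m j) -> 0 < residual_slope m i.
Proof.
move=> m_gt0; have [j ji] : exists j, j != i.
  have /card_gt0P[j] : (0 < #|predC1 i|)%N by rewrite cardC1 -subn1 subn_gt0.
  by exists j.
rewrite /residual_slope (bigD1 j) //= ltr_pwDl ?invr_gt0 //.
by apply: sumr_ge0 => k _; rewrite invr_ge0 ltW.
Qed.

Lemma residual_profitB m a i (x y : R) : (forall j, 0 < m j) ->
  first_order m a i x ->
  residual_profit m a i x - residual_profit m a i y =
  ((residual_slope m i)^-1 + 2^-1 * c i) * (y - x) ^+ 2.
Proof.
move=> m_gt0; have S_gt0 := residual_slope_gt0 i m_gt0.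
rewrite /first_order /residual_profit.
set S := residual_slope m i in S_gt0 *; set D := residual_intercept m a i.
move/eqP; rewrite eq_sym subr_eq => /eqP ->.
by field; rewrite gt_eqF.
Qed.

(** The price is at most every [m_j x_j + a_j]. Dividing by [m_j] and summing over the competitors
    bounds it by the residual line. *)
Lemma profit_le o i : (forall j, 0 < (o j).1) ->
  profit d c b o i <=
  residual_profit (fun j => (o j).1) (fun j => (o j).2) i (allocation d o i).
Proof.
move=> o_gt0; have S_gt0 := @residual_slope_gt0 (fun j => (o j).1) i o_gt0.
rewrite /profit /residual_profit !lerB //.
have [clr|->] := allocation_cases o; last by rewrite mulr0 mul0r.
have [[sumx x_ge0] _] := clr.
have [l xl] : exists l, 0 < allocation d o l.
  apply: contrapT => /forallNP no_active; move: d_gt0; rewrite -sumx.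
  rewrite big1 ?ltxx // => j _; apply: le_anti.
  by rewrite x_ge0 leNgt (introN idP (no_active j)).
rewrite mulrC ler_wpM2l // ler_pdivlMr // /residual_slope mulr_sumr.
set x := allocation d o in clr sumx x_ge0 xl *.
have -> : residual_intercept (fun j => (o j).1) (fun j => (o j).2) i - x i =
    \sum_(j | j != i) (x j + (o j).2 / (o j).1).
  by rewrite big_split /= /residual_intercept -sumx (bigD1 i) //=; ring.
apply: ler_sum => j _; rewrite ler_pdivrMr // mulrDl divfK ?gt_eqF //.
by rewrite [x j * _]mulrC (priceE o_gt0 xl) clearing_marginal_le.
Qed.

Lemma profit_all_active o i : (forall j, 0 < (o j).1) -> all_active d o ->
  profit d c b o i =
  residual_profit (fun j => (o j).1) (fun j => (o j).2) i (allocation d o i).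
Proof.
move=> o_gt0 act; have S_gt0 := @residual_slope_gt0 (fun j => (o j).1) i o_gt0.
rewrite /profit /residual_profit; congr (_ - _ - _).
have [[sumx x_ge0] _] := allocation_is_clearing (act i).
rewrite mulrC; congr (_ * _).
apply: (canRL (mulfK (lt0r_neq0 S_gt0))).
rewrite /residual_slope mulr_sumr; set x := allocation d o in sumx act *.
have -> : residual_intercept (fun j => (o j).1) (fun j => (o j).2) i - x i =
    \sum_(j | j != i) (x j + (o j).2 / (o j).1).
  by rewrite big_split /= /residual_intercept -sumx (bigD1 i) //=; ring.
apply: eq_bigr => j _; rewrite (priceE o_gt0 (act j)) -/x.
by rewrite mulrDl [_ * x j]mulrC mulfK ?gt_eqF //.
Qed.

(* Other producers may drop out after a deviation of [i], but this only makes
   the residual demand of [i] fall below its linear continuation. *)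
Lemma best_response m a o i : (forall j, 0 < m j) -> (forall j, 0 < (o j).1) ->
  all_active d (orders m a) ->
  first_order m a i (allocation d (orders m a) i) ->
  (forall j, j != i -> o j = orders m a j) ->
  profit d c b o i <= profit d c b (orders m a) i.
Proof.
move=> m_gt0 o_gt0 act foc eq_o; apply: (le_trans (profit_le i o_gt0)).
rewrite (@profit_all_active (orders m a)) //.
have -> : residual_profit (fun j => (o j).1) (fun j => (o j).2) i =
    residual_profit m a i.
  by apply: eq_residual_profit => j ji; rewrite eq_o.
rewrite -subr_ge0 (residual_profitB _ m_gt0 foc) mulr_ge0 ?sqr_ge0 //.
by rewrite addr_ge0 ?mulr_ge0 ?invr_ge0 // ltW // residual_slope_gt0.
Qed.

Lemma marginal_all_active m a v x : (forall j, 0 < m j) ->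
  (forall i, m i * x i + a i = v) -> \sum_i x i = d -> (forall i, 0 < x i) ->
  allocation d (orders m a) = x.
Proof.
by move=> m_gt0 xv sumx x_gt0; apply: (@allocationE _ _ v) => // i; exact: ltW.
Qed.

(* If producer [i] is not at the vertex of its concave residual profit, a small
   move towards the vertex keeps everyone active and increases its profit. *)
Lemma intercept_nash_first_order m a i : (forall j, 0 < m j) ->
  all_active d (orders m a) -> intercept_nash d c b m a ->
  first_order m a i (allocation d (orders m a) i).
Proof.
move=> m_gt0 act [_ nashP].
have S_gt0 := residual_slope_gt0 i m_gt0.
have [[sumx _] _] := allocation_is_clearing (act i).
have v_eq j : m j * allocation d (orders m a) j + a j = price d (orders m a).
  by rewrite (@priceE (orders m a) j m_gt0 (act j)).
set x := allocation d (orders m a) in sumx v_eq *.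
set v := price d (orders m a) in v_eq *.
set S := residual_slope m i in S_gt0 *.
pose xs := (residual_intercept m a i - b i * S) / (2 + c i * S).
have den_gt0 : 0 < 2 + c i * S by rewrite addr_gt0 // mulr_gt0.
have foc : first_order m a i xs by rewrite /first_order -/S divfK // gt_eqF.
suff -> : x i = xs by [].
apply/eqP; rewrite eq_sym -subr_eq0; apply: contraT => neq.
pose dx := xs - x i.
(* Producer [i] moves towards the vertex and the competitors follow their supply lines as the price
   changes by [- dx / S]; the entries of [g] sum to zero. *)
pose g j := if j == i then dx else - dx / (S * m j).
have x_gt0 j : 0 < x j := act j.
(* The step size [t = 1 / (1 + T)] makes [t * |g j| < x j] for all [j] at once. *)
pose T := \sum_j `|g j| / x j.
have T_ge0 : 0 <= T by apply: sumr_ge0 => j _; rewrite divr_ge0 // ltW.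
pose t := (1 + T)^-1.
have T1_gt0 : 0 < 1 + T by rewrite ltr_pwDl.
have t_gt0 : 0 < t by rewrite invr_gt0.
have t_le1 : t <= 1 by rewrite invf_le1 // lerDl.
pose y j := x j + t * g j.
have y_gt0 j : 0 < y j.
  have : `|g j| < (1 + T) * x j.
    rewrite -ltr_pdivrMr // /T (bigD1 j) //=.
    rewrite addrCA ltrDl ltr_pwDl // sumr_ge0 // => k _.
    by rewrite divr_ge0 // ltW.
  rewrite -ltr_pdivrMl // -/t => lt_x.
  have : - (t * g j) <= t * `|g j| by rewrite -mulrN ler_pM2l // -normrN ler_norm.
  by rewrite /y; lra.
pose v' := v - t * (dx / S).
(* This intercept realises [y]: it puts the marginal ask of [i] at the new price [v'], where [g]
   already puts the others. *)
pose ai := v' - m i * y i.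
pose a' := [eta a with i |-> ai].
have a'x j : m j * y j + a' j = v'.
  rewrite /a' /= /y /g; case: eqP => [->|_].
    by rewrite /ai /y /g eqxx; ring.
  by rewrite /v' -(v_eq j); field; rewrite !gt_eqF.
have sumy : \sum_j y j = d.
  rewrite /y big_split /= sumx -mulr_sumr (bigD1 i) //= /g eqxx.
  rewrite (eq_bigr (fun j => - dx / S * (m j)^-1)); last first.
    by move=> j /negPf ->; rewrite invfM mulrA.
  rewrite -mulr_sumr -/(residual_slope m i) -/S; field.
  by rewrite gt_eqF.
have ally := marginal_all_active m_gt0 a'x sumy y_gt0.
have acty : all_active d (orders m a') by move=> j; rewrite ally.
have := nashP i ai I; rewrite -/a'.
rewrite (@profit_all_active (orders m a')) // (@profit_all_active (orders m a)) //.
rewrite ally -/x.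
have -> : residual_profit (fun j => (orders m a' j).1)
    (fun j => (orders m a' j).2) i = residual_profit m a i.
  by apply: eq_residual_profit => // j /negPf /= ->.
have := residual_profitB (x i) m_gt0 foc.
have := residual_profitB (y i) m_gt0 foc.
set q := residual_profit _ _ _; rewrite -/S => qy qx.
have yi : y i - xs = (1 - t) * (x i - xs) by rewrite /y /g eqxx /dx; ring.
move: qy; rewrite yi exprMn => qy le_q.
(* The distance to the vertex shrinks by the factor [1 - t], so the gain has the factor
   [1 - (1 - t)^2 = t (2 - t)]. *)
have : 0 < (S^-1 + 2^-1 * c i) * (x i - xs) ^+ 2 * (t * (2 - t)).
  have a_gt0 : 0 < S^-1 + 2^-1 * c i by rewrite addr_gt0 ?mulr_gt0 ?invr_gt0.
  rewrite pmulr_rgt0; first by rewrite mulr_gt0 //; lra.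
  by rewrite pmulr_rgt0 // exprn_even_gt0 //= -oppr_eq0 opprB.
by rewrite ltNge => /negP; case; lra.
Qed.

(** * Closed form of the equilibrium and the linear system *)

Definition fo_weight m i : R :=
  residual_slope m i / (1 + c i * residual_slope m i).

Definition nash_price m : R :=
  (d + \sum_i fo_weight m i * b i) / \sum_i fo_weight m i.

Definition nash_quantity m i : R := fo_weight m i * (nash_price m - b i).

Definition nash_intercept m i : R := nash_price m - m i * nash_quantity m i.

Lemma fo_weight_gt0 m i : (forall j, 0 < m j) -> 0 < fo_weight m i.
Proof.
move=> m_gt0; have S_gt0 := residual_slope_gt0 i m_gt0.
by rewrite divr_gt0 // addr_gt0 // mulr_gt0.
Qed.

Lemma sum_gt0 (F : P -> R) : (forall i, 0 < F i) -> 0 < \sum_i F i.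
Proof.
move=> F_gt0; have /card_gt0P[i _] : (0 < #|P|)%N by exact: ltnW.
rewrite (bigD1 i) //= ltr_pwDl //; apply: sumr_ge0 => j _; exact: ltW.
Qed.

Lemma sum_nash_quantity m : (forall j, 0 < m j) -> \sum_i nash_quantity m i = d.
Proof.
move=> m_gt0; rewrite /nash_quantity.
under eq_bigr do rewrite mulrBr.
rewrite sumrB -mulr_suml /nash_price mulrC divfK ?addrK //.
by rewrite gt_eqF // sum_gt0 // => i; exact: fo_weight_gt0.
Qed.

(* The first-order conditions give each quantity as an affine function of the
   common price, which is then determined by the demand. *)
Lemma first_order_nash_intercept m a v x : (forall j, 0 < m j) ->
  (forall i, m i * x i + a i = v) -> \sum_i x i = d ->
  (forall i, first_order m a i (x i)) <-> a = nash_intercept m.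
Proof.
move=> m_gt0 xv sumx.
have foP i : first_order m a i (x i) <-> x i = fo_weight m i * (v - b i).
  have S_gt0 := residual_slope_gt0 i m_gt0.
  have w_neq0 : 1 + c i * residual_slope m i != 0.
    by rewrite gt_eqF // addr_gt0 // mulr_gt0.
  have DE : residual_intercept m a i = x i + v * residual_slope m i.
    rewrite /residual_intercept -sumx (bigD1 i) //= -addrA; congr (_ + _).
    rewrite -big_split mulr_sumr; apply: eq_bigr => j _ /=.
    by rewrite -(xv j) mulrDl [_ * x j]mulrC mulfK ?gt_eqF.
  rewrite /first_order DE /fo_weight mulrAC; split=> [fo|->].
    by apply: (canRL (mulfK w_neq0)); lra.
  by field.
split=> [fo|aE i].
  have x_eq i : x i = fo_weight m i * (v - b i) by apply/foP.
  have vE : v = nash_price m.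
    have W_neq0 : \sum_i fo_weight m i != 0.
      by rewrite gt_eqF // sum_gt0 // => i; exact: fo_weight_gt0.
    apply: (canRL (mulfK W_neq0)).
    rewrite -sumx mulr_sumr -big_split; apply: eq_bigr => i _ /=.
    by rewrite x_eq; ring.
  apply/funext => i.
  by rewrite /nash_intercept /nash_quantity -vE -x_eq -(xv i); ring.
have vE : v = nash_price m.
  (* For the same intercepts, both [x] and [nash_quantity m] equalise marginal asks and sum to [d];
     total supply is strictly increasing in the price, so their prices agree. *)
  have Minv_gt0 : 0 < \sum_i (m i)^-1 by apply: sum_gt0 => j; rewrite invr_gt0.
  apply: (mulIf (lt0r_neq0 Minv_gt0)); apply: (addIr (- \sum_i a i / m i)).
  have demand u y : (forall i, m i * y i + a i = u) ->
      u * (\sum_i (m i)^-1) - \sum_i a i / m i = \sum_i y i.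
    move=> yu; rewrite mulr_sumr -sumrB; apply: eq_bigr => j _.
    by rewrite -(yu j) mulrDl addrK [_ * y j]mulrC mulfK ?gt_eqF.
  rewrite (demand v x) // (demand _ (nash_quantity m)) ?sum_nash_quantity //.
  by move=> j; rewrite aE /nash_intercept; ring.
apply/foP; have := xv i; rewrite aE /nash_intercept vE => xvi.
apply: (mulfI (lt0r_neq0 (m_gt0 i))); rewrite -/(nash_quantity m i); lra.
Qed.

(** The quantity inserted is the supply [(v - a_i) / m_i] at the price [v] where total supply is
    [d]. Away from the pole, each equation times [1 - k_i K2_i] is the first-order condition. *)
Lemma linear_system_first_order m a : (forall j, 0 < m j) ->
  linear_system d c b m a <->
  forall i, first_order m a i
    (((d + \sum_j a j / m j) / (\sum_j (m j)^-1) - a i) / m i).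
Proof.
move=> m_gt0.
suff eqv i : (if 1 - kcoef c m i * K2 m i == 0 then
      \sum_(j | j != i) a i / m j = \sum_(j | j != i) b i / m j
    else
      theta c m i * (\sum_(j | j != i) a i / m j) - \sum_(j | j != i) a j / m j
      = d + (theta c m i - 1) * \sum_(j | j != i) b i / m j) <->
    first_order m a i
    (((d + \sum_j a j / m j) / (\sum_j (m j)^-1) - a i) / m i).
  by split=> lin i; apply/eqv/lin.
have S_gt0 := residual_slope_gt0 i m_gt0.
rewrite /theta /K2 /kcoef /first_order /residual_intercept.
rewrite -!mulr_sumr [\sum_j a j / m j](bigD1 i) //= [\sum_j (m j)^-1](bigD1 i) //=.
rewrite -/(residual_slope m i); set S := residual_slope m i in S_gt0 *.
set A := \sum_(_ | _) _; set mi := m i; have mi_gt0 : 0 < mi := m_gt0 i.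
set k := (2 * mi - c i) * _.
have mS_gt0 : 0 < 1 + mi * S by rewrite addr_gt0 // mulr_gt0.
have kE : k = (2 * mi - c i) * S / (1 + mi * S).
  by rewrite /k; field; rewrite !gt_eqF.
set foL := _ * (2 + c i * S); set foR := d + A - b i * S.
have foE : foL - foR = (1 - k) * (d + A) - (2 - k) * (a i * S) + b i * S.
  rewrite kE /foL /foR; field.
  by rewrite !gt_eqF //; rewrite -addrC; lra.
have -> : (foL = foR) <-> (foL - foR = 0).
  by split=> [->|/eqP]; [rewrite subrr | rewrite subr_eq0 => /eqP].
(* At the pole [2 - k = 1], and [foE] leaves only [a_i S = b_i S]. *)
rewrite foE; case: eqP => [k1|/eqP k1].
  have -> : 2 - k = 1 by lra.
  by rewrite k1 mul0r; split=> E; lra.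
split=> [E|E].
  have /(congr1 ( *%R (1 - k))) := E.
  have -> : (1 - k) * ((2 - k) / (1 - k) * (a i * S) - A) =
    (2 - k) * (a i * S) - (1 - k) * A by field.
  have -> : (1 - k) * (d + ((2 - k) / (1 - k) - 1) * (b i * S)) =
    (1 - k) * d + b i * S by field.
  lra.
apply: (mulfI k1).
have -> : (1 - k) * ((2 - k) / (1 - k) * (a i * S) - A) =
  (2 - k) * (a i * S) - (1 - k) * A by field.
have -> : (1 - k) * (d + ((2 - k) / (1 - k) - 1) * (b i * S)) =
  (1 - k) * d + b i * S by field.
lra.
Qed.

Lemma linear_systemP m a : (forall j, 0 < m j) ->
  linear_system d c b m a <-> a = nash_intercept m.
Proof.
move=> m_gt0; have Minv_gt0 : 0 < \sum_i (m i)^-1.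
  by apply: sum_gt0 => j; rewrite invr_gt0.
rewrite linear_system_first_order //.
set v := (d + _) / _.
apply: (@first_order_nash_intercept m a v (fun i => (v - a i) / m i)) => // [i|].
  by rewrite mulrC divfK ?gt_eqF // subrK.
under eq_bigr do rewrite mulrBl.
by rewrite sumrB -mulr_sumr /v divfK ?gt_eqF // addrK.
Qed.

(** * Equilibria in the intercepts and in the pairs *)

Lemma all_active_first_order m a : (forall j, 0 < m j) ->
  all_active d (orders m a) ->
  (forall i, first_order m a i (allocation d (orders m a) i)) <->
  a = nash_intercept m.
Proof.
move=> m_gt0 act; have /card_gt0P[i0 _] : (0 < #|P|)%N by exact: ltnW.
have [[sumx _] _] := allocation_is_clearing (act i0).
apply: (@first_order_nash_intercept _ _ (price d (orders m a))) => // i.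
by rewrite (@priceE (orders m a) i m_gt0 (act i)).
Qed.

Lemma slopes_gt0 m : slopes c m -> forall j, 0 < m j.
Proof. by move=> Sm j; apply: lt_le_trans (Sm j); rewrite mulr_gt0 ?invr_gt0. Qed.

Lemma intercept_nashP m a : (forall j, 0 < m j) -> all_active d (orders m a) ->
  intercept_nash d c b m a <-> a = nash_intercept m.
Proof.
move=> m_gt0 act; rewrite -all_active_first_order //; split=> [na i|fo].
  exact: intercept_nash_first_order.
split=> // i t _; apply: (best_response (m := m)) => // j /negPf ji.
by rewrite /orders /= ji.
Qed.

Lemma local_nash_intercept m : slopes c m ->
  all_active d (orders m (nash_intercept m)) ->
  local_nash (strategies c) (profit d c b) (orders m (nash_intercept m)).
Proof.
move=> Sm act; have m_gt0 := slopes_gt0 Sm; split=> [i|i]; first exact: Sm.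
(* The inequality holds for every admissible [t], not only near the profile. *)
rewrite near_withinE; apply: nearW => t St; apply: best_response => // [j||j /negPf ji].
  rewrite /=; case: eqP => _; last exact: m_gt0.
  by apply: (@lt_le_trans _ _ (2^-1 * c i)); [rewrite mulr_gt0 ?invr_gt0 | exact: St].
  exact: (all_active_first_order m_gt0 act).2.
by rewrite /= ji.
Qed.

(** * Infinitely many equilibria with everyone active *)

Lemma all_active_nash_intercept m : (forall j, 0 < m j) ->
  (forall i, b i < nash_price m) -> all_active d (orders m (nash_intercept m)).
Proof.
move=> m_gt0 lt_b.
have q_gt0 i : 0 < nash_quantity m i by rewrite mulr_gt0 ?fo_weight_gt0 ?subr_gt0.
suff q_eq : allocation d (orders m (nash_intercept m)) = nash_quantity m.
  by move=> i; rewrite q_eq.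
apply: (@marginal_all_active _ _ (nash_price m)) => // [i|].
  by rewrite /nash_intercept; ring.
exact: sum_nash_quantity.
Qed.

(* Steep asks make the residual supply inelastic, which pushes the price above
   every marginal cost at zero. *)
Lemma steep_all_active : exists M0 : R, forall M, M0 <= M ->
  slopes c (fun=> M) /\
  all_active d (orders (fun=> M) (nash_intercept (fun=> M))).
Proof.
pose B := \sum_i \sum_j `|b i - b j|; pose n : R := #|P|%:R.
have row_ge0 i : 0 <= \sum_j `|b i - b j| by apply: sumr_ge0.
have B_ge0 : 0 <= B by apply: sumr_ge0.
have C_ge0 : 0 <= \sum_i c i by apply: sumr_ge0 => i _; exact: ltW.
(* The sum of the [c i] makes [M] admissible. The last term forces [n / M * B < d]; since the
   weights are at most [n / M], differences between the [b j] cannot outweigh the demand. *)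
exists (1 + \sum_i c i + n * B / d) => M leM.
have nB_ge0 : 0 <= n * B / d by rewrite divr_ge0 ?mulr_ge0 // ltW.
have M_gt0 : 0 < M by lra.
split=> [i /=|].
  have : c i <= \sum_i c i.
    by rewrite (bigD1 i) //= lerDl; apply: sumr_ge0 => j _; exact: ltW.
  by have := c_gt0 i; lra.
set m : P -> R := fun=> M; have m_gt0 : forall j, 0 < m j by [].
apply: all_active_nash_intercept => // i.
have w_gt0 j := fo_weight_gt0 j m_gt0.
rewrite /nash_price ltr_pdivlMr ?sum_gt0 // -subr_gt0 -addrA mulr_sumr -sumrB.
have w_le j : fo_weight m j <= n / M.
  have S_gt0 := residual_slope_gt0 j m_gt0.
  apply: (@le_trans _ _ (residual_slope m j)).
    rewrite /fo_weight ler_pdivrMr ?ler_peMr ?ltW // ?ltrDl ?lerDl ?mulr_gt0 //.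
    by rewrite addr_gt0 // mulr_gt0.
  apply: (@le_trans _ _ (\sum_(k : P) (m k)^-1)).
    by rewrite [leRHS](bigD1 j) //= lerDr invr_ge0 ltW.
  by rewrite /m /n sumr_const mulr_natl; exact: lexx.
have nB_lt : n / M * B < d.
  by rewrite mulrAC ltr_pdivrMr // [d * M]mulrC -ltr_pdivrMr //; lra.
suff : - (n / M * B) <= \sum_j (fo_weight m j * b j - b i * fo_weight m j) by lra.
apply: (@le_trans _ _ (\sum_j - (n / M * `|b i - b j|))).
  rewrite sumrN -mulr_sumr lerN2 ler_wpM2l //; first by rewrite divr_ge0 // ltW.
  by rewrite /B [leRHS](bigD1 i) //= lerDl sumr_ge0.
apply: ler_sum => j _; rewrite lerNl.
have -> : - (fo_weight m j * b j - b i * fo_weight m j) = fo_weight m j * (b i - b j).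
  by ring.
apply: (le_trans (ler_norm _)); rewrite normrM gtr0_norm //.
by rewrite ler_wpM2r.
Qed.

(** The common slopes [M0 + k], for natural [k], give active equilibria told apart by their
    slopes. *)
Lemma infinite_local_nash :
  infinite_set [set o : P -> R * R | all_active d o /\
    local_nash (strategies c) (profit d c b) o].
Proof.
have [M0 steep] := steep_all_active.
have /card_gt0P[i0 _] : (0 < #|P|)%N by exact: ltnW.
pose m (k : nat) : P -> R := fun=> M0 + k%:R.
pose o (k : nat) := orders (m k) (nash_intercept (m k)).
have o_inj : injective o.
  move=> k l /(congr1 (fun f => (f i0).1)) /addrI /eqP.
  by rewrite eqr_nat => /eqP.
move=> fin; apply: infinite_nat.
have -> : [set: nat] = o @^-1` [set o : P -> R * R | all_active d o /\
    local_nash (strategies c) (profit d c b) o].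
  apply/esym/seteqP; split=> // k _ /=.
  have [] : slopes c (m k) /\ all_active d (o k) by apply: steep; rewrite lerDl.
  move=> Sm act.
  by split=> //; exact: local_nash_intercept.
apply: finite_preimage fin => x y _ _; exact: o_inj.
Qed.

(** * Continuity of the equilibrium intercepts *)

(** The closed form is rational in the slopes, with denominators positive at [m]. *)
Lemma cvg_nash_intercept (X : Type) (F : set_system X) (M : X -> P -> R) m i :
  Filter F -> (forall j, 0 < m j) -> (forall j, M x j @[x --> F] --> m j) ->
  nash_intercept (M x) i @[x --> F] --> nash_intercept m i.
Proof.
move=> FF m_gt0 cm.
have cS j : residual_slope (M x) j @[x --> F] --> residual_slope m j.
  by apply: cvg_sumr => k; apply: cvgV; [rewrite gt_eqF | exact: cm].
have cw j : fo_weight (M x) j @[x --> F] --> fo_weight m j.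
  apply: cvgM; first exact: cS.
  apply: cvgV.
    by rewrite gt_eqF // addr_gt0 // mulr_gt0 // residual_slope_gt0.
  by apply: cvgD; [exact: cvg_cst | apply: cvgM; [exact: cvg_cst | exact: cS]].
have cv : nash_price (M x) @[x --> F] --> nash_price m.
  apply: cvgM; last first.
    apply: cvgV; last by apply: cvg_sumr => j; exact: cw.
    by rewrite gt_eqF // sum_gt0 // => j; exact: fo_weight_gt0.
  apply: cvgD; [exact: cvg_cst | apply: cvg_sumr => j].
  by apply: cvgM; [exact: cw | exact: cvg_cst].
apply: cvgB; first exact: cv.
apply: cvgM; first exact: cm.
apply: cvgM; first exact: cw.
by apply: cvgB; [exact: cv | exact: cvg_cst].
Qed.

Lemma nash_intercept_continuous :
  {within (slopes c : set {ptws P -> R}),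
    continuous (nash_intercept : {ptws P -> R} -> {ptws P -> R})}.
Proof.
(* Continuity is proved at each admissible [m] in the whole function space, then restricted. *)
apply: continuous_in_subspaceT => m /set_mem Sm.
have Fm : Filter (nbhs m) by exact: nbhs_filter.
apply: (@cvg_ptws P _ R (nbhs m) nash_intercept (nash_intercept m)) => i.
apply: (@cvg_nash_intercept _ _ id) => [|j]; first exact: slopes_gt0.
exact: (@proj_continuous P (fun=> R) j m).
Qed.

End Market.

Theorem theorem2 (R : realType) (P : finType) (d : R) (c b : P -> R)
    (card_P : (1 < #|P|)%N) (d_gt0 : 0 < d) (c_gt0 : forall i, 0 < c i) :
  exists aplus : {ptws P -> R} -> {ptws P -> R},
    [/\ forall m, slopes c m ->
          forall a, linear_system d c b m a <-> a = aplus m,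
        forall m, slopes c m ->
          forall a, all_active d (orders m a) ->
            (intercept_nash d c b m a <-> a = aplus m),
        forall m, slopes c m -> all_active d (orders m (aplus m)) ->
          local_nash (strategies c) (profit d c b) (orders m (aplus m)),
        infinite_set [set o : P -> R * R | all_active d o /\
          local_nash (strategies c) (profit d c b) o] &
        {within (slopes c : set {ptws P -> R}), continuous aplus}].
Proof.
exists (nash_intercept d c b); split.
- by move=> m /(slopes_gt0 c_gt0) m_gt0 a; exact: linear_systemP.
- by move=> m /(slopes_gt0 c_gt0) m_gt0 a; exact: intercept_nashP.
- by move=> m; exact: local_nash_intercept.
- exact: infinite_local_nash.
- exact: nash_intercept_continuous.
Qed.
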